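(* For every $\delta>0$ there is a constant $K_\delta>0$ such that for all integers $N\ge 1$, \[ \frac{1}{3\pi^2}N^4 - K_\delta N^{3+\delta} \;\le\; \#3\mathrm{iet}(N) \;\le\; \frac{2}{\pi^2}N^4 + K_\delta N^{3+\delta}. \]
   Context: For $\varepsilon\in(0,1)\setminus\mathbb{Q}$ and $\ell$ with $\max\{\varepsilon,1-\varepsilon\}<\ell<1$, define $T_{\varepsilon,\ell}:[0,\ell)\to[0,\ell)$ by $T_{\varepsilon,\ell}(x)=x+1-\varepsilon$ on $I_A=[0,\ell-1+\varepsilon)$, $T_{\varepsilon,\ell}(x)=x+1-2\varepsilon$ on $I_B=[\ell-1+\varepsilon,\varepsilon)$, and $T_{\varepsilon,\ell}(x)=x-\varepsilon$ on $I_C=[\varepsilon,\ell)$ (exchange of three intervals with permutation $(3,2,1)$). For $x_0\in[0,\ell)$, the 3iet word $u_{\varepsilon,\ell,x_0}=(u_n)_{n\in\mathbb{Z}}\in\{A,B,C\}^{\mathbb{Z}}$ is given by $u_n=X$ iff $T_{\varepsilon,\ell}^n(x_0)\in I_X$, $X\in\{A,B,C\}$. A 3iet factor is a finite word $u_iu_{i+1}\cdots u_{i+n-1}$ occurring in some 3iet word (for some admissible $\varepsilon,\ell,x_0$). $3\mathrm{iet}(N)$ denotes the set of all 3iet factors of length $N$. *)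

(* Defs.v *)
From Stdlib Require Import Reals ZArith List.
Open Scope R_scope.

Inductive letter := A | B | C.

Definition irrational (e : R) : Prop :=
  forall (p : Z) (q : positive), e <> IZR p / IZR (Zpos q).

Definition admissible (e l : R) : Prop :=
  0 < e < 1 /\ irrational e /\ Rmax e (1 - e) < l /\ l < 1.

(* the 3-interval exchange T_{eps,l} on [0,l) *)
Definition T3 (e l x : R) : R :=
  if Rlt_dec x (l - 1 + e) then x + 1 - e
  else if Rlt_dec x e then x + 1 - 2 * e
  else x - e.

Definition T3inv (e l y : R) : R :=
  if Rlt_dec y (l - e) then y + e
  else if Rlt_dec y (1 - e) then y - 1 + 2 * e
  else y - 1 + e.

Definition T3pow (e l : R) (n : Z) (x : R) : R :=
  match n with
  | Z0 => x
  | Zpos p => Nat.iter (Pos.to_nat p) (T3 e l) x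
  | Zneg p => Nat.iter (Pos.to_nat p) (T3inv e l) x
  end.

Definition letter_of (e l x : R) : letter :=
  if Rlt_dec x (l - 1 + e) then A
  else if Rlt_dec x e then B
  else C.

Definition iet_word (e l x0 : R) (n : Z) : letter :=
  letter_of e l (T3pow e l n x0).

Definition is_3iet_factor (w : list letter) : Prop :=
  exists (e l x0 : R) (i : Z),
    admissible e l /\ 0 <= x0 < l /\
    w = map (fun k => iet_word e l x0 (i + Z.of_nat k)%Z) (seq 0 (length w)).

(* Main.v *)
From Stdlib Require Import Reals ZArith List Lra Lia Permutation ClassicalEpsilon.
Require Import Defs.
Open Scope R_scope.

(** A word is a 3iet factor iff finitely many strict linear inequalities in
    [(e, l, x)] are solvable, so words of length [N] are open convex cells in a
    3-dimensional parameter space.  Passing from [N] to [N + 1], a cell splits for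
    each of the two planes [x = 1 - e], [x = l - e] which it meets; the traces on one
    plane are again convex cells, which split along the lines where the orbit of
    [1 - e] ends at [e] or at [l - 1 + e].  The traces on these lines are determined
    by the displacement of the orbit, since two of them with the same displacement
    live in nested strips with equally many points: there are at most
    [(N + 1) (N + 2) / 2] of each kind.  Conversely each coprime pair [P, Q <= N + 1]
    with [P + Q >= N + 2] gives a trace of the first kind, on [e = P / (P + Q)].
    Summing three times bounds the count between [2 d / 4! N^4] and [4 / 4! N^4] up to
    [O(N^3)], where [d] is any lower bound for the density of coprime pairs; [d = 4/9]
    is elementary, and [9 <= PI^2 <= 12] concludes. *)

(** * Open codings of words and the displacement of an orbit *)

Definition region (a : letter) (e l x : R) : Prop :=
  match a with
  | A => 0 < x < l - 1 + e
  | B => l - 1 + e < x < e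
  | C => e < x < l
  end.

(** [T3] is the first return to [[0, l)] of the rotation [x - e] modulo 1. A letter takes [rot1]
    rotation steps, of which [nup1] wrap around. *)
Definition nup1 (a : letter) : nat := match a with A | B => 1 | C => 0 end.
Definition rot1 (a : letter) : nat := match a with B => 2 | _ => 1 end.
Definition nB1 (a : letter) : nat := match a with B => 1 | _ => 0 end.

Definition move (a : letter) (e : R) : R := INR (nup1 a) - INR (rot1 a) * e.

Fixpoint coded (e l x : R) (w : list letter) : Prop :=
  match w with
  | nil => 0 < x < l
  | a :: v => region a e l x /\ coded e l (x + move a e) v
  end.

Fixpoint endpoint (e x : R) (w : list letter) : R :=
  match w with
  | nil => x
  | a :: v => endpoint e (x + move a e) v
  end.

Definition nup (w : list letter) : nat := list_sum (map nup1 w).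
Definition rot (w : list letter) : nat := list_sum (map rot1 w).
Definition nB (w : list letter) : nat := list_sum (map nB1 w).

Definition adm (e l : R) : Prop := e < l /\ 1 - e < l /\ l < 1.

Lemma nup_cons a w : nup (a :: w) = (nup1 a + nup w)%nat.
Proof. reflexivity. Qed.

Lemma rot_cons a w : rot (a :: w) = (rot1 a + rot w)%nat.
Proof. reflexivity. Qed.

Lemma nB_cons a w : nB (a :: w) = (nB1 a + nB w)%nat.
Proof. reflexivity. Qed.

Lemma rot_length w : rot w = (length w + nB w)%nat.
Proof.
  induction w as [|a w IH]; [reflexivity|].
  rewrite rot_cons, nB_cons, IH; destruct a; simpl; lia.
Qed.

Lemma nup_le_length w : (nup w <= length w)%nat.
Proof.
  induction w as [|a w IH]; [reflexivity|].
  rewrite nup_cons; destruct a; simpl; lia.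
Qed.

Lemma nB_le_nup w : (nB w <= nup w)%nat.
Proof.
  induction w as [|a w IH]; [reflexivity|].
  rewrite nup_cons, nB_cons; destruct a; simpl; lia.
Qed.

Ltac unmove := unfold move in *; cbn [nup1 rot1 nB1 INR] in *.

Lemma endpoint_eq e x w : endpoint e x w = x + INR (nup w) - INR (rot w) * e.
Proof.
  revert x; induction w as [|a w IH]; intros x; simpl endpoint.
  - unfold nup, rot; simpl; ring.
  - rewrite IH, nup_cons, rot_cons, !plus_INR; unfold move; ring.
Qed.

Lemma coded_start e l x w : adm e l -> coded e l x w -> 0 < x < l.
Proof.
  unfold adm; destruct w as [|a w]; simpl; [tauto|].
  destruct a; simpl; lra.
Qed.

Lemma coded_end e l x w : coded e l x w -> 0 < endpoint e x w < l.
Proof.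
  revert x; induction w as [|a w IH]; intros x; simpl; [tauto|].
  intros [_ H]; auto.
Qed.

(** Under [adm] each branch maps its open interval into [(0, l)], so the region of the last letter
    already implies the final condition of [coded]. *)
Lemma coded_snoc e l x w a : adm e l ->
  (coded e l x (w ++ a :: nil) <-> coded e l x w /\ region a e l (endpoint e x w)).
Proof.
  unfold adm; intros Hadm; revert x; induction w as [|b w IH]; intros x; simpl.
  - destruct a; simpl; unmove; split; intros; repeat split; lra.
  - rewrite IH; tauto.
Qed.

(** * Openness and convexity of the cells *)

Lemma region_open a e l x : region a e l x ->
  exists r, 0 < r /\ forall e' l' x',
    Rabs (e' - e) < r -> Rabs (l' - l) < r -> Rabs (x' - x) < r -> region a e' l' x'.
Proof.
  (* Each inequality involves at most the three quantities [e], [l], [x], each moved by less than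
     [r]. *)
  assert (Hex : forall u v, 0 < u -> 0 < v -> exists r, 0 < r /\ 3 * r < u /\ 3 * r < v).
  { intros u v Hu Hv; exists (Rmin u v / 4).
    pose proof (Rmin_l u v); pose proof (Rmin_r u v).
    pose proof (Rmin_glb_lt u v 0 Hu Hv); repeat split; lra. }
  destruct a; simpl; intros [H1 H2];
  [destruct (Hex (x - 0) (l - 1 + e - x)) as (r & Hr & H3 & H4)
  |destruct (Hex (x - (l - 1 + e)) (e - x)) as (r & Hr & H3 & H4)
  |destruct (Hex (x - e) (l - x)) as (r & Hr & H3 & H4)]; try lra;
  exists r; split; try lra; intros e' l' x' He Hl Hx;
  apply Rabs_def2 in He, Hl, Hx; lra.
Qed.

Lemma coded_open w : forall e l x, coded e l x w ->
  exists r, 0 < r /\ forall e' l' x',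
    Rabs (e' - e) < r -> Rabs (l' - l) < r -> Rabs (x' - x) < r -> coded e' l' x' w.
Proof.
  induction w as [|a w IH]; intros e l x; simpl.
  - intros H; exists (Rmin x (l - x) / 4).
    pose proof (Rmin_l x (l - x)); pose proof (Rmin_r x (l - x)).
    pose proof (Rmin_glb_lt x (l - x) 0 ltac:(lra) ltac:(lra)).
    split; [lra|]; intros e' l' x' _ Hl Hx; apply Rabs_def2 in Hl, Hx; lra.
  - intros [Ha Hw].
    destruct (region_open _ _ _ _ Ha) as (r1 & Hr1 & H1).
    destruct (IH _ _ _ Hw) as (r2 & Hr2 & H2).
    (* The next point moves by at most the change of [x] plus twice that of [e]. *)
    exists (Rmin r1 (r2 / 3)).
    pose proof (Rmin_l r1 (r2 / 3)); pose proof (Rmin_r r1 (r2 / 3)).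
    pose proof (Rmin_glb_lt r1 (r2 / 3) 0 ltac:(lra) ltac:(lra)).
    split; [lra|]; intros e' l' x' He Hl Hx; split.
    + apply H1; lra.
    + apply H2; [lra|lra|].
      apply Rabs_def2 in He, Hx; apply Rabs_def1; destruct a; unmove; lra.
Qed.

(** The ball is closed so that later perturbations may have size exactly [r]. *)
Lemma adm_coded_open e l x w : adm e l -> coded e l x w ->
  exists r, 0 < r /\ forall e' l' x',
    Rabs (e' - e) <= r -> Rabs (l' - l) <= r -> Rabs (x' - x) <= r ->
    adm e' l' /\ coded e' l' x' w.
Proof.
  intros (H1 & H2 & H3) Hw.
  destruct (coded_open _ _ _ _ Hw) as (r & Hr & H).
  set (s := Rmin (Rmin (l - e) (l - (1 - e))) (Rmin (1 - l) r)).
  assert (Hs : 0 < s) by (unfold s; repeat apply Rmin_glb_lt; lra).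
  assert (s <= l - e /\ s <= l - (1 - e) /\ s <= 1 - l /\ s <= r) as (S1 & S2 & S3 & S4).
  { unfold s; repeat split.
    - eapply Rle_trans; [apply Rmin_l|apply Rmin_l].
    - eapply Rle_trans; [apply Rmin_l|apply Rmin_r].
    - eapply Rle_trans; [apply Rmin_r|apply Rmin_l].
    - eapply Rle_trans; [apply Rmin_r|apply Rmin_r]. }
  exists (s / 3); split; [lra|]; intros e' l' x' He Hl Hx; split.
  - assert (He' : Rabs (e' - e) < s / 2) by lra.
    assert (Hl' : Rabs (l' - l) < s / 2) by lra.
    apply Rabs_def2 in He', Hl'; unfold adm; lra.
  - apply H; lra.
Qed.

Definition mix (t u v : R) : R := (1 - t) * u + t * v.

Lemma mix_pos t u v : 0 <= t <= 1 -> 0 < u -> 0 < v -> 0 < mix t u v.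
Proof. unfold mix; intros; destruct (Req_dec t 0); nra. Qed.

Lemma mix_lt t u v u' v' : 0 <= t <= 1 -> u < u' -> v < v' -> mix t u v < mix t u' v'.
Proof.
  intros Ht Hu Hv; pose proof (mix_pos t (u' - u) (v' - v) Ht ltac:(lra) ltac:(lra)) as H.
  unfold mix in *; lra.
Qed.

Lemma region_convex t a e l x e' l' x' : 0 <= t <= 1 ->
  region a e l x -> region a e' l' x' -> region a (mix t e e') (mix t l l') (mix t x x').
Proof.
  intros Ht; destruct a; simpl; intros [H1 H2] [H3 H4];
  pose proof (mix_lt t _ _ _ _ Ht H1 H3); pose proof (mix_lt t _ _ _ _ Ht H2 H4);
  unfold mix in *; lra.
Qed.

(** All conditions are strict inequalities that are affine in [(e, l, x)] jointly. *)
Lemma coded_convex t w : 0 <= t <= 1 -> forall e l x e' l' x',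
  coded e l x w -> coded e' l' x' w -> coded (mix t e e') (mix t l l') (mix t x x') w.
Proof.
  intros Ht; induction w as [|a w IH]; intros e l x e' l' x'; simpl.
  - intros [H1 H2] [H3 H4].
    pose proof (mix_lt t _ _ _ _ Ht H1 H3); pose proof (mix_lt t _ _ _ _ Ht H2 H4);
    unfold mix in *; lra.
  - intros [H1 H2] [H3 H4]; split; [apply region_convex; auto|].
    replace (mix t x x' + move a (mix t e e'))
      with (mix t (x + move a e) (x' + move a e')) by (unfold mix, move; ring).
    auto.
Qed.

Lemma adm_convex t e l e' l' : 0 <= t <= 1 ->
  adm e l -> adm e' l' -> adm (mix t e e') (mix t l l').
Proof.
  intros Ht (H1 & H2 & H3) (H4 & H5 & H6).
  pose proof (mix_lt t _ _ _ _ Ht H1 H4); pose proof (mix_lt t _ _ _ _ Ht H2 H5);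
  pose proof (mix_lt t _ _ _ _ Ht H3 H6); unfold adm, mix in *; lra.
Qed.

(** Finds where a segment of parameters crosses a plane: [u] and [v] are the values of an affine
    form at its two ends. *)
Lemma mix_zero u v : u < 0 -> 0 < v -> exists t, 0 <= t <= 1 /\ mix t u v = 0.
Proof.
  intros Hu Hv; exists (- u / (v - u)); unfold mix; repeat split.
  - apply Rle_mult_inv_pos; lra.
  - apply Rmult_le_reg_r with (v - u); [lra|]; unfold Rdiv.
    rewrite Rmult_assoc, Rinv_l; lra.
  - field; lra.
Qed.

Lemma mix_zero' u v : 0 < u -> v < 0 -> exists t, 0 <= t <= 1 /\ mix t u v = 0.
Proof.
  intros Hu Hv; destruct (mix_zero (- u) (- v)) as (t & Ht & H); [lra|lra|].
  exists t; split; auto; unfold mix in *; lra.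
Qed.

(** * Reflection symmetry, special and bispecial words *)

Definition swap (a : letter) : letter := match a with A => C | B => B | C => A end.

(** The reflection [x -> l - x] turns the exchange for [e] into the one for [1 - e], so results on
    [special1] carry over to [special2]. *)
Lemma coded_swap w : forall e l x,
  coded e l x w -> coded (1 - e) l (l - x) (map swap w).
Proof.
  induction w as [|a w IH]; intros e l x; simpl; [lra|].
  intros [Ha Hw]; split; [destruct a; simpl in *; lra|].
  replace (l - x + move (swap a) (1 - e)) with (l - (x + move a e)); [auto|].
  destruct a; unmove; simpl; ring.
Qed.

Lemma adm_swap e l : adm e l -> adm (1 - e) l.
Proof. unfold adm; lra. Qed.

(* [special1] and [special2] are the codings started at a discontinuity of the
   inverse map, namely [1 - e] and [l - e]; [bispecial1] and [bispecial2] also end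
   at a discontinuity of the map, namely [e] and [l - 1 + e]. *)
Definition factor (w : list letter) : Prop :=
  exists e l x, adm e l /\ coded e l x w.
Definition special1 (w : list letter) : Prop :=
  exists e l, adm e l /\ coded e l (1 - e) w.
Definition special2 (w : list letter) : Prop :=
  exists e l, adm e l /\ coded e l (l - e) w.
Definition bispecial1 (w : list letter) : Prop :=
  exists e l, adm e l /\ coded e l (1 - e) w /\ endpoint e (1 - e) w = e.
Definition bispecial2 (w : list letter) : Prop :=
  exists e l, adm e l /\ coded e l (1 - e) w /\ endpoint e (1 - e) w = l - 1 + e.

Lemma swap_swap w : map swap (map swap w) = w.
Proof.
  rewrite map_map; rewrite <- map_id; apply map_ext; intros []; reflexivity.
Qed.

Lemma special2_swap w : special2 (map swap w) <-> special1 w.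
Proof.
  split; intros (e & l & Hadm & Hw); exists (1 - e), l; split;
  try (apply adm_swap; assumption); apply coded_swap in Hw.
  - rewrite swap_swap in Hw.
    replace (1 - (1 - e)) with (l - (l - e)) by ring; exact Hw.
  - exact Hw.
Qed.

(** * Left extensions of factors *)

Lemma factor_tail a w : factor (a :: w) -> factor w.
Proof. intros (e & l & x & Hadm & _ & Hw); exists e, l, (x + move a e); auto. Qed.

Lemma Rabs_small u r : - r <= u <= r -> Rabs u <= r.
Proof. intros; apply Rabs_le; lra. Qed.

Ltac small := apply Rabs_small; lra.

(** The point [1 - e] is the common end of the images of [A] and [B]: points just above it come from
    just above 0, points just below it from just below [e]. *)
Lemma special1_factor w : special1 w -> factor (A :: w) /\ factor (B :: w).
Proof.
  intros (e & l & Hadm & Hw).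
  destruct (adm_coded_open _ _ _ _ Hadm Hw) as (r & Hr & H).
  set (s := Rmin r (Rmin (l - 1 + e) (1 - l)) / 2).
  assert (0 < s /\ s < r /\ s < l - 1 + e /\ s < 1 - l) as (S0 & S1 & S2 & S3).
  { unfold adm in Hadm.
    assert (0 < Rmin r (Rmin (l - 1 + e) (1 - l))) by (repeat apply Rmin_glb_lt; lra).
    pose proof (Rmin_l r (Rmin (l - 1 + e) (1 - l))).
    pose proof (Rmin_r r (Rmin (l - 1 + e) (1 - l))).
    pose proof (Rmin_l (l - 1 + e) (1 - l)); pose proof (Rmin_r (l - 1 + e) (1 - l)).
    unfold s; repeat split; lra. }
  split.
  - exists e, l, s; split; [auto|]; split; [simpl; lra|].
    apply H; unmove; small.
  - exists e, l, (e - s); split; [auto|]; split; [simpl; lra|].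
    apply H; unmove; small.
Qed.

Lemma factor_swap w : factor w -> factor (map swap w).
Proof.
  intros (e & l & x & Hadm & Hw); exists (1 - e), l, (l - x); split.
  - apply adm_swap; auto.
  - apply coded_swap; auto.
Qed.

Lemma special2_factor w : special2 w -> factor (B :: w) /\ factor (C :: w).
Proof.
  intros Hw; rewrite <- (swap_swap w) in Hw; apply (proj1 (special2_swap _)) in Hw.
  apply special1_factor in Hw; destruct Hw as [HA HB].
  apply factor_swap in HA, HB; simpl in HA, HB; rewrite swap_swap in *; auto.
Qed.

(** Images under [A] lie above [1 - e], those under [B] and [C] below it; the segment joining the
    two parameter points therefore meets the plane, and it stays in the cell of [w]. *)
Lemma factor_special1 a w : a <> A -> factor (A :: w) -> factor (a :: w) -> special1 w.
Proof.
  intros Ha (e & l & x & Hadm & Hx & Hw) (e' & l' & x' & Hadm' & Hx' & Hw').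
  destruct (mix_zero' (x + move A e - (1 - e)) (x' + move a e' - (1 - e')))
    as (t & Ht & Hmix).
  - simpl in Hx; unmove; lra.
  - unfold adm in Hadm'; destruct a; [congruence| |]; simpl in Hx'; unmove; lra.
  - exists (mix t e e'), (mix t l l'); split; [apply adm_convex; auto|].
    set (y := x + move A e) in *; set (y' := x' + move a e') in *.
    replace (1 - mix t e e') with (mix t y y') by (unfold mix in *; lra).
    apply coded_convex; auto.
Qed.

Lemma factor_special2 a w : a <> C -> factor (C :: w) -> factor (a :: w) -> special2 w.
Proof.
  intros Ha HC Hw; rewrite <- (swap_swap w); apply special2_swap.
  apply factor_swap in HC, Hw; apply factor_special1 with (a := swap a); auto.
  destruct a; simpl; congruence.
Qed.

Lemma factor_extend w : factor w -> exists a, factor (a :: w).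
Proof.
  intros (e & l & x & Hadm & Hw).
  pose proof (coded_start _ _ _ _ Hadm Hw) as Hx.
  destruct (Rtotal_order x (l - e)) as [H|[H|H]].
  - exists C, e, l, (x + e); split; [auto|]; split; [simpl; lra|].
    replace (x + e + move C e) with x by (unmove; ring); auto.
  (* At either discontinuity of the inverse map, [B] is one of the two possible letters. *)
  - exists B; apply special2_factor; exists e, l; subst x; auto.
  - destruct (Rtotal_order x (1 - e)) as [H'|[H'|H']].
    + exists B, e, l, (x + 2 * e - 1); split; [auto|]; split; [simpl; lra|].
      replace (x + 2 * e - 1 + move B e) with x by (unmove; ring); auto.
    + exists B; apply special1_factor; exists e, l; subst x; auto.
    + exists A, e, l, (x + e - 1); split; [auto|]; split; [simpl; lra|].
      replace (x + e - 1 + move A e) with x by (unmove; ring); auto.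
Qed.

(** * Right extensions of special words *)

Lemma special1_init w a : special1 (w ++ a :: nil) -> special1 w.
Proof.
  intros (e & l & Hadm & Hw); exists e, l; split; auto.
  apply coded_snoc in Hw; tauto.
Qed.

Lemma bispecial1_special1 w : bispecial1 w ->
  special1 (w ++ B :: nil) /\ special1 (w ++ C :: nil).
Proof.
  intros (e & l & Hadm & Hw & Hend).
  destruct (adm_coded_open _ _ _ _ Hadm Hw) as (r & Hr & H).
  rewrite endpoint_eq in Hend.
  pose proof (pos_INR (rot w)) as Hrot.
  (* With the start at [1 - e], the difference between the endpoint and [e] is affine in [e] with
     slope [- k]; a shift of [e] by [s] moves it by [k * s]. *)
  set (k := INR (rot w) + 2) in *.
  set (s := Rmin r (Rmin (1 - l) (l - e) / k) / 2).
  assert (0 < s /\ s < r /\ k * s < 1 - l /\ k * s < l - e) as (S0 & S1 & S2 & S3).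
  { unfold adm in Hadm; unfold s.
    set (u := Rmin (1 - l) (l - e)).
    assert (Hu : 0 < u) by (apply Rmin_glb_lt; lra).
    assert (0 < u / k) by (apply Rdiv_lt_0_compat; unfold k; lra).
    assert (u <= 1 - l) by apply Rmin_l. assert (u <= l - e) by apply Rmin_r.
    assert (0 < Rmin r (u / k)) by (apply Rmin_glb_lt; lra).
    pose proof (Rmin_l r (u / k)); pose proof (Rmin_r r (u / k)).
    assert (k * (Rmin r (u / k) / 2) < u).
    { apply Rle_lt_trans with (k * (u / k / 2)).
      - apply Rmult_le_compat_l; [unfold k|]; lra.
      - replace (k * (u / k / 2)) with (u / 2) by (field; unfold k; lra); lra. }
    repeat split; lra. }
  split.
  - exists (e + s), l.
    destruct (H (e + s) l (1 - (e + s))) as [Hadm' Hw']; try small.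
    split; [auto|]; apply coded_snoc; auto; split; [auto|].
    rewrite endpoint_eq; unfold adm in *; simpl; unfold k in *; split; nra.
  - exists (e - s), l.
    destruct (H (e - s) l (1 - (e - s))) as [Hadm' Hw']; try small.
    split; [auto|]; apply coded_snoc; auto; split; [auto|].
    rewrite endpoint_eq; unfold adm in *; simpl; unfold k in *; split; nra.
Qed.

(** The points of the orbit of [1 - e] do not depend on [l], while the discontinuity [l - 1 + e]
    moves with [l] across the endpoint. *)
Lemma bispecial2_special1 w : bispecial2 w ->
  special1 (w ++ A :: nil) /\ special1 (w ++ B :: nil).
Proof.
  intros (e & l & Hadm & Hw & Hend).
  pose proof (coded_end _ _ _ _ Hw) as Hend'.
  destruct (adm_coded_open _ _ _ _ Hadm Hw) as (r & Hr & H).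
  split.
  - exists e, (l + r); destruct (H e (l + r) (1 - e)) as [Hadm' Hw']; try small.
    split; [auto|]; apply coded_snoc; auto; split; [auto|]; simpl; lra.
  - exists e, (l - r); destruct (H e (l - r) (1 - e)) as [Hadm' Hw']; try small.
    split; [auto|]; apply coded_snoc; auto; split; [auto|]; simpl.
    unfold adm in Hadm; lra.
Qed.

Lemma endpoint_mix t e x e' x' w :
  endpoint (mix t e e') (mix t x x') w = mix t (endpoint e x w) (endpoint e' x' w).
Proof. rewrite !endpoint_eq; unfold mix; ring. Qed.

(** The start [1 - e] is affine in [e], so the segment between two points of the trace stays in its
    plane; along it the endpoint passes from above [e] to below. *)
Lemma special1_bispecial1 a w : a <> C ->
  special1 (w ++ C :: nil) -> special1 (w ++ a :: nil) -> bispecial1 w.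
Proof.
  intros Ha (e & l & Hadm & Hw) (e' & l' & Hadm' & Hw').
  apply coded_snoc in Hw, Hw'; auto; destruct Hw as [Hw Hx], Hw' as [Hw' Hx'].
  destruct (mix_zero' (endpoint e (1 - e) w - e) (endpoint e' (1 - e') w - e'))
    as (t & Ht & Hmix).
  - simpl in Hx; lra.
  - unfold adm in Hadm'; destruct a; [| |congruence]; simpl in Hx'; lra.
  - exists (mix t e e'), (mix t l l'); split; [apply adm_convex; auto|].
    replace (1 - mix t e e') with (mix t (1 - e) (1 - e')) by (unfold mix; ring).
    split; [apply coded_convex; auto|].
    rewrite endpoint_mix; unfold mix in *; lra.
Qed.

Lemma special1_bispecial2 a w : a <> A ->
  special1 (w ++ A :: nil) -> special1 (w ++ a :: nil) -> bispecial2 w.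
Proof.
  intros Ha (e & l & Hadm & Hw) (e' & l' & Hadm' & Hw').
  apply coded_snoc in Hw, Hw'; auto; destruct Hw as [Hw Hx], Hw' as [Hw' Hx'].
  destruct (mix_zero (endpoint e (1 - e) w - (l - 1 + e))
              (endpoint e' (1 - e') w - (l' - 1 + e'))) as (t & Ht & Hmix).
  - simpl in Hx; lra.
  - unfold adm in Hadm'; destruct a; [congruence| |]; simpl in Hx'; lra.
  - exists (mix t e e'), (mix t l l'); split; [apply adm_convex; auto|].
    replace (1 - mix t e e') with (mix t (1 - e) (1 - e')) by (unfold mix; ring).
    split; [apply coded_convex; auto|].
    rewrite endpoint_mix; unfold mix in *; lra.
Qed.

Lemma special1_extend w : special1 w -> exists a, special1 (w ++ a :: nil).
Proof.
  intros (e & l & Hadm & Hw).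
  pose proof (coded_end _ _ _ _ Hw) as Hx.
  set (z := endpoint e (1 - e) w) in *.
  destruct (Rtotal_order z (l - 1 + e)) as [H|[H|H]].
  - exists A, e, l; split; auto; apply coded_snoc; auto; split; auto; simpl; fold z; lra.
  - exists B; apply bispecial2_special1; exists e, l; auto.
  - destruct (Rtotal_order z e) as [H'|[H'|H']].
    + exists B, e, l; split; auto; apply coded_snoc; auto; split; auto; simpl; fold z; lra.
    + exists B; apply bispecial1_special1; exists e, l; auto.
    + exists C, e, l; split; auto; apply coded_snoc; auto; split; auto; simpl; fold z; lra.
Qed.

(** * Bispecial words are determined by their displacement *)

(* The strip of the primed parameters is contained in the other one up to time
   [rot w], so every point visited by [w'] is visited by [w]. *)
Lemma strip_compare w' : forall w e l x e' l' x',
  adm e l -> adm e' l' -> coded e l x w -> coded e' l' x' w' -> rot w = rot w' ->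
  (forall j k : nat, (j <= rot w)%nat ->
     0 < x' + INR k - INR j * e' < l' -> 0 < x + INR k - INR j * e < l) ->
  (nB w <= nB w')%nat /\ (nB w = nB w' -> w = w').
Proof.
  induction w' as [|a' w' IH]; intros w e l x e' l' x' Hadm Hadm' Hw Hw' Hrot Hincl.
  - destruct w as [|a w]; [split; auto|].
    rewrite rot_cons in Hrot; destruct a; discriminate Hrot.
  - destruct Hw' as [Hx' Hw'].
    pose proof (coded_start _ _ _ _ Hadm' Hw') as Hs'.
    (* The first point reached by [w'] also lies in the strip of [w]; this forces [a = a'] unless
       [a'] is [B]. *)
    assert (Hs : 0 < x + move a' e < l).
    { specialize (Hincl (rot1 a') (nup1 a')); unfold move in *.
      rewrite Hrot, rot_cons in Hincl; specialize (Hincl ltac:(lia)); lra. }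
    rewrite rot_cons in Hrot.
    assert (Hshift : forall v, coded e l (x + move a' e) v -> rot v = rot w' ->
               (nB v <= nB w')%nat /\ (nB v = nB w' -> v = w')).
    { intros v Hv Hrv; apply (IH v e l (x + move a' e) e' l' (x' + move a' e')); auto.
      intros j k Hj; specialize (Hincl (rot1 a' + j)%nat (nup1 a' + k)%nat ltac:(lia)).
      rewrite !plus_INR in Hincl; unfold move; intros.
      match goal with |- 0 < ?u < _ =>
        replace u with (x + (INR (nup1 a') + INR k) - (INR (rot1 a') + INR j) * e) by ring end.
      apply Hincl; lra. }
    clear Hincl.
    destruct w as [|a w]; [destruct a'; discriminate Hrot|].
    destruct Hw as [Hx Hw].
    pose proof (coded_start _ _ _ _ Hadm Hw) as Ht.
    rewrite rot_cons in Hrot.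
    unfold adm in Hadm, Hadm'.
    assert (Hsame : a = a' -> (nB (a :: w) <= nB (a' :: w'))%nat /\
                      (nB (a :: w) = nB (a' :: w') -> a :: w = a' :: w')).
    { intros ->; destruct (Hshift w Hw ltac:(lia)) as [H1 H2].
      rewrite !nB_cons; split; [lia|]; intros; f_equal; apply H2; lia. }
    (* Where [w'] reads [B], the orbit of [w] may stop midway and read [A], [C] or [C], [A]: the
       same displacement with one [B] fewer, so the inequality becomes strict. *)
    assert (Htwo : forall b v, w = b :: v -> a' = B -> a <> B -> b <> B ->
               x + move a e + move b e = x + move B e ->
               (nB (a :: w) <= nB (a' :: w'))%nat /\
                      (nB (a :: w) = nB (a' :: w') -> a :: w = a' :: w')).
    { intros b v -> -> Ha Hb Heq; destruct Hw as [_ Hv].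
      rewrite rot_cons in Hrot.
      rewrite Heq in Hv; destruct (Hshift v Hv) as [H1 _].
      - destruct a, b; simpl in *; try congruence; lia.
      - rewrite !nB_cons; destruct a, b; simpl in *; try congruence; split; lia. }
    destruct a', a; unmove; simpl in Hx, Hx'; try (apply Hsame; reflexivity); try lra;
    (destruct w as [|b w]; [exfalso; unfold rot in Hrot; simpl in Hrot; lia|];
     destruct Hw as [Hy _]; unfold region in Hy; destruct b; unmove; try lra;
     eapply Htwo; try reflexivity; try congruence; unmove; lra).
Qed.

Lemma bispecial1_inj w w' : bispecial1 w -> bispecial1 w' ->
  length w = length w' -> nup w = nup w' -> nB w = nB w' -> w = w'.
Proof.
  intros (e & l & Hadm & Hw & Hend) (e' & l' & Hadm' & Hw' & Hend') Hlen Hnup HnB.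
  assert (Hrot : rot w = rot w') by (rewrite !rot_length; lia).
  rewrite endpoint_eq in Hend, Hend'; rewrite <- Hrot, <- Hnup in Hend'.
  pose proof (pos_INR (rot w)).
  (* Both end conditions read [(rot w + 2) * e = nup w + 1]. The strips then have the same start and
     are nested according to [l]. *)
  assert (e = e') as <- by nra.
  destruct (Rle_dec l' l).
  - eapply (strip_compare w' w e l (1 - e) e l' (1 - e)); auto; intros; lra.
  - symmetry; eapply (strip_compare w w' e l' (1 - e) e l (1 - e)); auto; intros; lra.
Qed.

Lemma bispecial2_inj w w' : bispecial2 w -> bispecial2 w' ->
  length w = length w' -> nup w = nup w' -> nB w = nB w' -> w = w'.
Proof.
  intros Hb Hb' Hlen Hnup HnB.
  assert (Hrot : rot w = rot w') by (rewrite !rot_length; lia).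
  enough (Hle : forall w w' e l e' l', adm e l -> coded e l (1 - e) w ->
           endpoint e (1 - e) w = l - 1 + e -> adm e' l' -> coded e' l' (1 - e') w' ->
           endpoint e' (1 - e') w' = l' - 1 + e' -> nup w = nup w' -> nB w = nB w' ->
           rot w = rot w' -> e <= e' -> w = w').
  { destruct Hb as (e & l & Hadm & Hw & Hend), Hb' as (e' & l' & Hadm' & Hw' & Hend').
    destruct (Rle_dec e e').
    - apply (Hle w w' e l e' l'); auto.
    - symmetry; apply (Hle w' w e' l' e l); auto; lra. }
  clear; intros w w' e l e' l' Hadm Hw Hend Hadm' Hw' Hend' Hnup HnB Hrot He.
  rewrite endpoint_eq in Hend, Hend'; rewrite <- Hrot, <- Hnup in Hend'.
  eapply (strip_compare w' w e l (1 - e) e' l' (1 - e')); auto.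
  (* Here [l = nup w + 2 - (rot w + 2) * e]. Passing from [e'] down to [e] raises the point by
     [(j + 1) * (e' - e)] and the top of the strip by [(rot w + 2) * (e' - e)], which is at least as
     much. *)
  intros j k Hj; apply le_INR in Hj; pose proof (pos_INR j); intros [H1 H2]; split; nra.
Qed.

(** * The half-open exchange and its itineraries *)

Lemma T3_range e l x : adm e l -> 0 <= x < l -> 0 <= T3 e l x < l.
Proof.
  unfold adm, T3; intros; destruct (Rlt_dec x (l - 1 + e)), (Rlt_dec x e); lra.
Qed.

Lemma T3inv_range e l x : adm e l -> 0 <= x < l -> 0 <= T3inv e l x < l.
Proof.
  unfold adm, T3inv; intros; destruct (Rlt_dec x (l - e)), (Rlt_dec x (1 - e)); lra.
Qed.

Lemma T3_T3inv e l x : adm e l -> 0 <= x < l -> T3 e l (T3inv e l x) = x.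
Proof.
  unfold adm, T3inv, T3; intros.
  destruct (Rlt_dec x (l - e)), (Rlt_dec x (1 - e));
  repeat match goal with |- context [Rlt_dec ?u ?v] => destruct (Rlt_dec u v) end; lra.
Qed.

Lemma iter_inv_range e l x n : adm e l -> 0 <= x < l ->
  0 <= Nat.iter n (T3inv e l) x < l.
Proof. intros Hadm Hx; induction n; simpl; auto using T3inv_range. Qed.

Lemma iter_range e l x n : adm e l -> 0 <= x < l -> 0 <= Nat.iter n (T3 e l) x < l.
Proof. intros Hadm Hx; induction n; simpl; auto using T3_range. Qed.

Lemma T3pow_range e l x i : adm e l -> 0 <= x < l -> 0 <= T3pow e l i x < l.
Proof.
  destruct i; simpl; auto using iter_inv_range, iter_range.
Qed.

Lemma T3pow_of_nat e l x n : T3pow e l (Z.of_nat n) x = Nat.iter n (T3 e l) x.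
Proof.
  destruct n; [reflexivity|]; simpl Z.of_nat; unfold T3pow.
  rewrite SuccNat2Pos.id_succ; reflexivity.
Qed.

Lemma T3pow_opp_of_nat e l x n : T3pow e l (- Z.of_nat n) x = Nat.iter n (T3inv e l) x.
Proof.
  destruct n; [reflexivity|]; simpl Z.of_nat; simpl Z.opp; unfold T3pow.
  rewrite SuccNat2Pos.id_succ; reflexivity.
Qed.

Lemma T3pow_succ e l x i : adm e l -> 0 <= x < l ->
  T3pow e l (i + 1) x = T3 e l (T3pow e l i x).
Proof.
  intros Hadm Hx; destruct (Z_le_gt_dec 0 i) as [Hi|Hi].
  - rewrite <- (Z2Nat.id i) by auto.
    replace (Z.of_nat (Z.to_nat i) + 1)%Z with (Z.of_nat (S (Z.to_nat i))) by lia.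
    rewrite !T3pow_of_nat; reflexivity.
  - set (n := Z.to_nat (- i - 1)).
    replace (i + 1)%Z with (- Z.of_nat n)%Z by lia.
    replace i with (- Z.of_nat (S n))%Z by lia.
    rewrite !T3pow_opp_of_nat; simpl.
    rewrite T3_T3inv; auto using iter_inv_range.
Qed.

Lemma T3pow_add e l x i k : adm e l -> 0 <= x < l ->
  T3pow e l (i + Z.of_nat k) x = Nat.iter k (T3 e l) (T3pow e l i x).
Proof.
  intros Hadm Hx; induction k; [simpl; f_equal; lia|].
  replace (i + Z.of_nat (S k))%Z with ((i + Z.of_nat k) + 1)%Z by lia.
  rewrite T3pow_succ, IHk by auto; reflexivity.
Qed.

Definition itinerary (e l x : R) (n : nat) : list letter :=
  map (fun k => letter_of e l (Nat.iter k (T3 e l) x)) (seq 0 n).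

Lemma itinerary_succ e l x n :
  itinerary e l x (S n) = letter_of e l x :: itinerary e l (T3 e l x) n.
Proof.
  unfold itinerary; simpl; f_equal.
  rewrite <- seq_shift, map_map; apply map_ext; intros k.
  rewrite Nat.iter_succ_r; reflexivity.
Qed.

Lemma T3_move e l x : T3 e l x = x + move (letter_of e l x) e.
Proof.
  unfold T3, letter_of; destruct (Rlt_dec x (l - 1 + e)), (Rlt_dec x e);
  unfold move; simpl; ring.
Qed.

Lemma coded_itinerary e l w : adm e l -> forall x,
  coded e l x w -> w = itinerary e l x (length w).
Proof.
  intros Hadm; induction w as [|a w IH]; intros x; [reflexivity|]; intros [Hx Hw].
  simpl length; rewrite itinerary_succ, T3_move.
  assert (letter_of e l x = a) as ->.
  { unfold adm, letter_of in *.
    destruct (Rlt_dec x (l - 1 + e)), (Rlt_dec x e), a; simpl in Hx; auto; lra. }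
  f_equal; auto.
Qed.

(* Moving the intercept by [2 s] and the length by [s] turns all the non-strict
   inequalities of a half-open coding into strict ones. *)
Lemma itinerary_coded e l n : adm e l -> forall x, 0 <= x < l ->
  exists r, 0 < r /\ forall s, 0 < s <= r ->
    coded e (l + s) (x + 2 * s) (itinerary e l x n).
Proof.
  intros Hadm; induction n as [|n IH]; intros x Hx.
  - exists ((l - x) / 2); split; [lra|]; simpl; intros; lra.
  - destruct (IH (T3 e l x)) as (r & Hr & H); [apply T3_range; auto|].
    assert (Ha : exists r', 0 < r' /\ forall s, 0 < s <= r' ->
              region (letter_of e l x) e (l + s) (x + 2 * s)).
    { unfold letter_of, adm in *; destruct (Rlt_dec x (l - 1 + e)); [|destruct (Rlt_dec x e)].
      - exists ((l - 1 + e - x) / 2); split; [lra|]; simpl; intros; lra.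
      - exists ((e - x) / 3); split; [lra|]; simpl; intros; lra.
      - exists ((l - x) / 2); split; [lra|]; simpl; intros; lra. }
    destruct Ha as (r' & Hr' & Ha); exists (Rmin r r').
    pose proof (Rmin_l r r'); pose proof (Rmin_r r r').
    split; [apply Rmin_glb_lt; auto|]; intros s Hs.
    rewrite itinerary_succ; split; [apply Ha; lra|].
    rewrite T3_move in *.
    replace (x + 2 * s + move (letter_of e l x) e)
      with (x + move (letter_of e l x) e + 2 * s) by ring.
    apply H; lra.
Qed.

(** * Irrational parameters and the identification of 3iet factors *)

Lemma square_eq_double (p q : Z) : (p * p = 2 * (q * q))%Z -> q = 0%Z.
Proof.
  remember (Z.abs_nat q) as n eqn:Hn; revert p q Hn.
  induction n as [n IH] using lt_wf_ind; intros p q -> H.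
  destruct (Z.eq_dec q 0) as [|Hq]; [auto|exfalso].
  (* Infinite descent on the absolute value of [q]: [p] and then [q] are even, and halving both
     gives a smaller solution. *)
  destruct (Z.Even_or_Odd p) as [[p' ->]|[p' ->]]; [|lia].
  destruct (Z.Even_or_Odd q) as [[q' ->]|[q' ->]]; [|lia].
  assert (q' = 0)%Z; [|lia].
  apply (IH (Z.abs_nat q')) with (p := p'); lia.
Qed.

Lemma sqrt2_irrational (p q : Z) : q <> 0%Z -> sqrt 2 <> IZR p / IZR q.
Proof.
  intros Hq H; apply Hq, (square_eq_double p).
  assert (Hq' : IZR q <> 0) by (apply not_0_IZR; auto).
  apply eq_IZR; rewrite !mult_IZR.
  assert (H2 : sqrt 2 * sqrt 2 = 2) by (apply sqrt_sqrt; lra).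
  rewrite H in H2; rewrite <- H2; field; auto.
Qed.

Lemma irrational_near e r : 0 < r -> exists e', Rabs (e' - e) <= r /\ irrational e'.
Proof.
  intros Hr; destruct (classic (irrational e)) as [He|He].
  - exists e; split; auto; rewrite Rminus_diag, Rabs_R0; lra.
  - apply not_all_ex_not in He; destruct He as [p He].
    apply not_all_ex_not in He; destruct He as [q He]; apply NNPP in He.
    (* The shift will be [sqrt 2 / n]; the half makes up for [sqrt 2 < 2]. *)
    destruct (archimed_cor1 (r / 2)) as (n & Hn & Hn0); [lra|].
    assert (HnR : 0 < INR n) by (apply lt_0_INR; auto).
    assert (Hs : 0 < sqrt 2 < 2).
    { split; [apply sqrt_lt_R0; lra|].
      rewrite <- (sqrt_square 2) at 2 by lra; apply sqrt_lt_1; lra. }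
    exists (e + sqrt 2 / INR n); split.
    + replace (e + sqrt 2 / INR n - e) with (sqrt 2 * / INR n) by (unfold Rdiv; ring).
      assert (0 < / INR n) by (apply Rinv_0_lt_compat; auto).
      rewrite Rabs_pos_eq; nra.
    + intros p' q' H.
      apply (sqrt2_irrational (Z.of_nat n * (p' * Zpos q - p * Zpos q')) (Zpos q * Zpos q'));
        [lia|].
      assert (IZR (Zpos q) <> 0) by (apply not_0_IZR; lia).
      assert (IZR (Zpos q') <> 0) by (apply not_0_IZR; lia).
      rewrite !mult_IZR, minus_IZR, !mult_IZR, <- INR_IZR_INZ.
      replace (sqrt 2) with (INR n * ((e + sqrt 2 / INR n) - e)) by (field; lra).
      rewrite H, He; field; auto.
Qed.

Lemma admissible_adm e l : admissible e l -> adm e l.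
Proof.
  intros (_ & _ & H & H'); unfold adm.
  pose proof (Rmax_l e (1 - e)); pose proof (Rmax_r e (1 - e)); lra.
Qed.

(** Forwards, the word is read from [T3pow e l i x0] and its half-open itinerary is perturbed into a
    strict coding. Backwards, the cell is open and so contains a point with irrational [e]. *)
Lemma is_3iet_factor_iff w : is_3iet_factor w <-> factor w.
Proof.
  split.
  - intros (e & l & x0 & i & Hadm & Hx & Hw); apply admissible_adm in Hadm.
    assert (w = itinerary e l (T3pow e l i x0) (length w)) as ->.
    { rewrite Hw at 1; apply map_ext; intros k; unfold iet_word.
      rewrite T3pow_add; auto. }
    set (x := T3pow e l i x0).
    destruct (itinerary_coded e l (length w) Hadm x) as (r & Hr & H).
    { apply T3pow_range; auto. }
    (* The cap [(1 - l) / 2] keeps the new length below 1. *)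
    exists e, (l + Rmin r ((1 - l) / 2)), (x + 2 * Rmin r ((1 - l) / 2)).
    pose proof (Rmin_l r ((1 - l) / 2)); pose proof (Rmin_r r ((1 - l) / 2)).
    unfold adm in Hadm.
    assert (0 < Rmin r ((1 - l) / 2)) by (apply Rmin_glb_lt; lra).
    split; [unfold adm; lra|apply H; lra].
  - intros (e & l & x & Hadm & Hw).
    destruct (adm_coded_open _ _ _ _ Hadm Hw) as (r & Hr & H).
    destruct (irrational_near e r Hr) as (e' & He' & Hirr).
    destruct (H e' l x) as [Hadm' Hw']; auto; try (rewrite Rminus_diag, Rabs_R0; lra).
    exists e', l, x, 0%Z; repeat split; auto.
    + unfold adm in Hadm'; lra.
    + unfold adm in Hadm'; lra.
    + unfold adm in Hadm'; apply Rmax_lub_lt; lra.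
    + unfold adm in Hadm'; lra.
    + apply coded_start in Hw'; auto; lra.
    + apply coded_start in Hw'; auto; lra.
    + rewrite (coded_itinerary _ _ _ Hadm' _ Hw') at 1; apply map_ext; intros k.
      unfold iet_word; rewrite T3pow_add; auto; apply coded_start in Hw'; auto; lra.
Qed.

(** * Bispecial words from coprime pairs *)

(* [f] is an orbit of the rotation of Z/(P+Q) by [Q], and [h] stands for 1/(P+Q). *)
Lemma rational_coding (P Q K J : nat) (f : nat -> nat) (h : R) :
  (0 < P < K)%nat -> (0 < Q < K)%nat -> (K <= P + Q)%nat ->
  0 < h -> (INR P + INR Q) * h = 1 ->
  (forall j, (j < J)%nat -> f (S j) = if f j <? P then f j + Q else f j - P)%nat ->
  (forall j, (j <= J)%nat -> 0 < f j < P + Q)%nat -> (f J < K)%nat ->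
  forall n j, (j + n = J)%nat -> (f j < K)%nat ->
  exists w, coded (INR P * h) ((INR K - 1 / 2) * h) (INR (f j) * h) w /\
    rot w = n /\ nB w = length (filter (fun i => K <=? f i)%nat (seq j n)) /\
    endpoint (INR P * h) (INR (f j) * h) w = INR (f J) * h.
Proof.
  intros HP HQ HK Hh Hm Hstep Hpos HJ n.
  (* Strong induction, since [B] uses two steps of [f]. A value at least [K] is above the cut
     [K - 1/2]; it came from a value below [P] by adding [Q], and subtracting [P] brings it below
     [Q], hence below [K]. *)
  induction n as [n IH] using lt_wf_ind; intros j Hj Hfj.
  assert (HleK : forall a b : nat, (a < b)%nat -> INR a + 1 <= INR b).
  { intros a b Hab; rewrite <- S_INR; apply le_INR; lia. }
  destruct n as [|n].
  - assert (j = J) as -> by lia; exists nil; simpl; repeat split; auto.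
    + pose proof (lt_0_INR (f J) ltac:(apply Hpos; lia)); nra.
    + pose proof (HleK _ _ Hfj); nra.
  - pose proof (Hpos j ltac:(lia)) as Hj0.
    pose proof (Hpos (S j) ltac:(lia)) as Hj1.
    pose proof (Hstep j ltac:(lia)) as Hj2.
    assert (Hpos0 : 1 <= INR (f j)) by (apply (le_INR 1); lia).
    destruct (Nat.ltb_spec (f j) P) as [HfP|HfP].
    + assert (INR (f (S j)) = INR (f j) + INR Q) as Hj2R by (rewrite Hj2, plus_INR; auto).
      destruct (Nat.lt_ge_cases (f (S j)) K) as [HSK|HSK].
      * destruct (IH n ltac:(lia) (S j) ltac:(lia) HSK) as (w & Hw & Hrot & HB & Hend).
        pose proof (HleK _ _ HSK).
        exists (A :: w).
        assert (Hx : INR (f j) * h + move A (INR P * h) = INR (f (S j)) * h)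
          by (unmove; nra).
        simpl coded; simpl endpoint; rewrite Hx, rot_cons, nB_cons.
        repeat split; auto; try nra; try (simpl; lia).
        simpl seq; simpl filter; apply Nat.leb_gt in Hfj; rewrite Hfj; auto.
      * assert (S j <> J) by (intros E; rewrite E in HSK; lia).
        destruct n as [|n]; [lia|].
        pose proof (Hpos (S (S j)) ltac:(lia)) as Hj3.
        pose proof (Hstep (S j) ltac:(lia)) as Hj4.
        destruct (Nat.ltb_spec (f (S j)) P) as [HfP'|HfP']; [lia|].
        assert (INR (f (S (S j))) = INR (f j) + INR Q - INR P) as Hj4R
          by (rewrite Hj4, minus_INR, Hj2R; auto).
        destruct (IH n ltac:(lia) (S (S j)) ltac:(lia) ltac:(lia))
          as (w & Hw & Hrot & HB & Hend).
        apply le_INR in HSK; pose proof (HleK _ _ HfP).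
        exists (B :: w).
        assert (Hx : INR (f j) * h + move B (INR P * h) = INR (f (S (S j))) * h)
          by (unmove; nra).
        simpl coded; simpl endpoint; rewrite Hx, rot_cons, nB_cons.
        repeat split; auto; try nra; try (simpl; lia).
        simpl seq; simpl filter; apply Nat.leb_gt in Hfj; rewrite Hfj.
        apply INR_le in HSK; apply Nat.leb_le in HSK; rewrite HSK; simpl; auto.
    + assert (f j <> P) by lia.
      assert (INR (f (S j)) = INR (f j) - INR P) as Hj2R by (rewrite Hj2, minus_INR; auto).
      destruct (IH n ltac:(lia) (S j) ltac:(lia) ltac:(lia)) as (w & Hw & Hrot & HB & Hend).
      pose proof (HleK _ _ Hfj); pose proof (HleK P (f j) ltac:(lia)).
      exists (C :: w).
      assert (Hx : INR (f j) * h + move C (INR P * h) = INR (f (S j)) * h)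
        by (unmove; nra).
      simpl coded; simpl endpoint; rewrite Hx, rot_cons, nB_cons.
      repeat split; auto; try nra; try (simpl; lia).
      simpl seq; simpl filter; apply Nat.leb_gt in Hfj; rewrite Hfj; auto.
Qed.

Lemma filter_leb_seq K a n : (a <= K <= a + n)%nat ->
  length (filter (Nat.leb K) (seq a n)) = (a + n - K)%nat.
Proof.
  revert a; induction n as [|n IH]; intros a Ha; simpl; [lia|].
  destruct (Nat.leb_spec K a); simpl.
  - assert (a = K) as -> by lia.
    replace (filter (Nat.leb K) (seq (S K) n)) with (seq (S K) n); [rewrite length_seq; lia|].
    symmetry; apply forallb_filter_id, forallb_forall; intros x Hx.
    apply in_seq in Hx; apply Nat.leb_le; lia.
  - rewrite IH; lia.
Qed.

(** By Gauss's lemma, multiplication by [Q] is injective modulo [m] and avoids 0. *)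
Lemma multiples_permutation (m Q : nat) : (1 < m)%nat -> Nat.gcd m Q = 1%nat ->
  Permutation (map (fun j => (S j * Q) mod m)%nat (seq 0 (m - 1))) (seq 1 (m - 1)).
Proof.
  intros Hm Hgcd; apply NoDup_Permutation_bis.
  - apply NoDup_map_NoDup_ForallPairs; [|apply seq_NoDup].
    enough (Hle : forall i j, (i <= j < m)%nat ->
      ((S i * Q) mod m = (S j * Q) mod m)%nat -> i = j).
    { intros i j Hi Hj H; apply in_seq in Hi, Hj.
      destruct (Nat.le_ge_cases i j); [|symmetry]; apply Hle; auto; lia. }
    intros i j Hij H.
    assert (Hdiv : Nat.divide m (Q * (j - i))%nat).
    { pose proof (Nat.div_mod_eq (S i * Q) m); pose proof (Nat.div_mod_eq (S j * Q) m).
      exists ((S j * Q) / m - (S i * Q) / m)%nat; nia. }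
    apply Nat.gauss in Hdiv; auto; destruct Hdiv as [[|c] Hc]; [lia|].
    rewrite Nat.mul_succ_l in Hc; lia.
  - rewrite length_map, !length_seq; auto.
  - intros x Hx; apply in_map_iff in Hx; destruct Hx as (j & <- & Hj).
    apply in_seq in Hj; apply in_seq.
    pose proof (Nat.mod_upper_bound (S j * Q) m ltac:(lia)).
    destruct (Nat.eq_dec ((S j * Q) mod m) 0) as [H0|H0]; [|lia].
    exfalso; apply Nat.Lcm0.mod_divide in H0.
    rewrite Nat.mul_comm in H0; apply Nat.gauss in H0; auto.
    destruct H0 as [[|c] Hc]; [lia|]; rewrite Nat.mul_succ_l in Hc; lia.
Qed.

Lemma length_filter_map {X Y} (g : X -> Y) p l :
  length (filter p (map g l)) = length (filter (fun x => p (g x)) l).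
Proof.
  induction l as [|x l IH]; simpl; [auto|]; destruct (p (g x)); simpl; auto.
Qed.

Lemma Permutation_length_filter {X} (p : X -> bool) l l' :
  Permutation l l' -> length (filter p l) = length (filter p l').
Proof.
  induction 1; simpl; repeat match goal with |- context [p ?x] => destruct (p x) end;
  simpl; congruence.
Qed.

(** For [e = P / m] with [m = P + Q], the rotation orbit of [1 - e = Q / m] runs through all nonzero
    multiples of [1 / m] and reaches [e] after [m - 2] steps. *)
Lemma bispecial1_of_coprime (P Q N : nat) :
  (1 <= P <= N + 1)%nat -> (1 <= Q <= N + 1)%nat -> (N + 2 <= P + Q)%nat ->
  Nat.gcd P Q = 1%nat ->
  exists w, bispecial1 w /\ length w = N /\ P = (nup w + 1)%nat /\ Q = (rot w + 2 - P)%nat.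
Proof.
  intros HP HQ HPQ Hgcd.
  remember (P + Q)%nat as m eqn:Hm.
  remember (N + 2)%nat as K eqn:HK.
  set (f := fun j => ((S j * Q) mod m)%nat).
  assert (Hf0 : f 0%nat = Q) by (unfold f; rewrite Nat.mul_1_l, Nat.mod_small; lia).
  assert (HfS : forall j, f (S j) = ((f j + Q) mod m)%nat).
  { intros j; unfold f; replace (S (S j) * Q)%nat with (S j * Q + Q)%nat by lia.
    rewrite Nat.Div0.add_mod_idemp_l; auto. }
  assert (Hgcd' : Nat.gcd m Q = 1%nat).
  { subst m; rewrite Nat.gcd_comm, Nat.gcd_add_diag_r, Nat.gcd_comm; auto. }
  assert (Hperm := multiples_permutation m Q ltac:(lia) Hgcd').
  assert (Hlt : forall j, (f j < m)%nat) by (intros; apply Nat.mod_upper_bound; lia).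
  assert (Hstep : forall j, (f (S j) = if f j <? P then f j + Q else f j - P)%nat).
  { intros j; rewrite HfS; pose proof (Hlt j); destruct (Nat.ltb_spec (f j) P).
    - apply Nat.mod_small; lia.
    - symmetry; apply Nat.mod_unique with (q := 1%nat); lia. }
  assert (Hpos : forall j, (j <= m - 2)%nat -> (0 < f j < P + Q)%nat).
  { intros j Hj; rewrite <- Hm.
    assert (In (f j) (seq 1 (m - 1))) as Hin.
    { eapply Permutation_in; [apply Hperm|]; apply (in_map f), in_seq; lia. }
    apply in_seq in Hin; lia. }
  assert (Hlast : f (m - 2)%nat = P).
  (* Indeed [(m - 1) * Q = m * (Q - 1) + P]. *)
  { unfold f; symmetry; apply Nat.mod_unique with (q := (Q - 1)%nat); [lia|].
    replace (S (m - 2)) with (m - 1)%nat by lia; nia. }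
  assert (HmR : 0 < INR m) by (apply lt_0_INR; lia).
  assert (HmR' : INR m = INR P + INR Q) by (subst m; apply plus_INR).
  assert (Hh : 0 < / INR m) by (apply Rinv_0_lt_compat; auto).
  assert (Hhm : (INR P + INR Q) * / INR m = 1) by (rewrite <- HmR'; field; lra).
  destruct (rational_coding P Q K (m - 2) f (/ INR m)) with (n := (m - 2)%nat) (j := 0%nat)
    as (w & Hw & Hrot & HB & Hend); auto; try lia.
  rewrite Hf0 in *; rewrite Hlast in Hend.
  set (e := INR P * / INR m) in *.
  replace (INR Q * / INR m) with (1 - e) in * by (unfold e; lra).
  assert (Hlen : length w = N).
  { assert (HnB : nB w = (m - K)%nat).
    { assert (Hc : length (filter (fun i => K <=? f i)%nat (seq 0 (m - 1))) = (m - K)%nat).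
      { rewrite <- (length_filter_map f), (Permutation_length_filter _ _ _ Hperm).
        rewrite filter_leb_seq; lia. }
      replace (m - 1)%nat with (m - 2 + 1)%nat in Hc by lia.
      rewrite seq_app, filter_app, length_app in Hc; simpl in Hc; rewrite Hlast in Hc.
      destruct (Nat.leb_spec K P); [lia|simpl in Hc; lia]. }
    pose proof (rot_length w); lia. }
  exists w; split; [|split; [auto|]].
  - exists e, ((INR K - 1 / 2) * / INR m).
    split; [|split; auto].
    assert (INR P <= INR N + 1) by (rewrite <- S_INR; apply le_INR; lia).
    assert (INR Q <= INR N + 1) by (rewrite <- S_INR; apply le_INR; lia).
    assert (INR K = INR N + 2) by (subst K; rewrite plus_INR; simpl; lra).
    assert (INR K <= INR m) by (apply le_INR; lia).
    unfold adm, e; repeat split; nra.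
  - rewrite endpoint_eq, Hrot, minus_INR in Hend by lia; simpl in Hend.
    assert (He : e * INR m = INR P) by (unfold e; field; lra).
    assert (INR P = INR (nup w + 1)) as HPR by (rewrite plus_INR; simpl; nra).
    apply INR_eq in HPR; lia.
Qed.

(** * Density of coprime pairs in a triangle *)

Definition dprod {X Y} (l : list X) (g : X -> list Y) : list (X * Y) :=
  flat_map (fun a => map (pair a) (g a)) l.

Lemma in_dprod {X Y} (l : list X) (g : X -> list Y) a b :
  In (a, b) (dprod l g) <-> In a l /\ In b (g a).
Proof.
  unfold dprod; rewrite in_flat_map; split.
  - intros (x & Hx & H); apply in_map_iff in H; destruct H as (y & [= -> ->] & Hy); auto.
  - intros [Ha Hb]; exists a; split; auto; apply in_map; auto.
Qed.

Lemma NoDup_dprod {X Y} (l : list X) (g : X -> list Y) :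
  NoDup l -> (forall a, NoDup (g a)) -> NoDup (dprod l g).
Proof.
  intros Hl Hg; induction Hl as [|a l Ha Hl IH]; [constructor|].
  change (NoDup (map (pair a) (g a) ++ dprod l g)); apply NoDup_app; auto.
  - apply FinFun.Injective_map_NoDup; auto; intros x y [=]; auto.
  - intros [x y] Hx Hx'; apply in_map_iff in Hx; destruct Hx as (z & [= -> ->] & _).
    apply in_dprod in Hx'; tauto.
Qed.

Lemma length_dprod {X Y} (l : list X) (g : X -> list Y) :
  length (dprod l g) = list_sum (map (fun a => length (g a)) l).
Proof.
  induction l as [|a l IH]; [reflexivity|].
  change (length (map (pair a) (g a) ++ dprod l g) =
          (length (g a) + list_sum (map (fun a => length (g a)) l))%nat).
  rewrite length_app, length_map, IH; reflexivity.
Qed.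

Lemma sum_seq a n : (2 * list_sum (seq a n) + n = n * (2 * a + n))%nat.
Proof.
  revert a; induction n as [|n IH]; intros a; simpl; [lia|].
  specialize (IH (S a)); nia.
Qed.

Definition triangle (M : nat) : list (nat * nat) :=
  dprod (seq 1 M) (fun P => seq (M + 1 - P) P).

Lemma in_triangle M P Q :
  In (P, Q) (triangle M) <-> (1 <= P <= M /\ 1 <= Q <= M /\ M < P + Q)%nat.
Proof. unfold triangle; rewrite in_dprod, !in_seq; lia. Qed.

Lemma NoDup_triangle M : NoDup (triangle M).
Proof. apply NoDup_dprod; intros; apply seq_NoDup. Qed.

Lemma length_triangle M : (2 * length (triangle M) = M * (M + 1))%nat.
Proof.
  unfold triangle; rewrite length_dprod.
  rewrite (map_ext _ (fun P => P)) by (intros; apply length_seq).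
  rewrite map_id; pose proof (sum_seq 1 M); lia.
Qed.

Definition coprime_triangle (M : nat) : list (nat * nat) :=
  filter (fun x => Nat.gcd (fst x) (snd x) =? 1)%nat (triangle M).

(** A sieve by 2 and all odd numbers from 3 on. The sum of their inverse squares is at most
    [1/4 + 1/4] by telescoping, which leaves a positive density. *)
Definition trial_divisors (M : nat) : list nat :=
  (2 :: map (fun i => 2 * i + 3) (seq 0 M))%nat.

Lemma trial_divisor M P Q : (1 <= P <= M)%nat -> Nat.gcd P Q <> 1%nat ->
  exists d, In d (trial_divisors M) /\ Nat.divide d P /\ Nat.divide d Q.
Proof.
  intros HP Hg; set (g := Nat.gcd P Q) in *.
  assert (HgP : Nat.divide g P) by apply Nat.gcd_divide_l.
  assert (HgQ : Nat.divide g Q) by apply Nat.gcd_divide_r.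
  assert (Hg0 : g <> 0%nat) by (intros H; destruct HgP; nia).
  assert (g <= P)%nat by (apply Nat.divide_pos_le; auto; lia).
  destruct (Nat.Even_or_Odd g) as [[c Hc]|[c Hc]].
  - assert (Nat.divide 2 g) by (exists c; lia).
    exists 2%nat; split; [left; auto|]; split; eapply Nat.divide_trans; eauto.
  - exists g; split; [|auto]; right; apply in_map_iff; exists (c - 1)%nat.
    rewrite in_seq; lia.
Qed.

(* The multiples of [d] in a triangle form a scaled smaller triangle. *)
Lemma triangle_incl M :
  incl (triangle M)
    (coprime_triangle M ++
     flat_map (fun d => map (fun x => (d * fst x, d * snd x)%nat) (triangle (M / d)))
       (trial_divisors M)).
Proof.
  intros [P Q] Hin; apply in_or_app.
  destruct (Nat.eq_dec (Nat.gcd P Q) 1) as [Hg|Hg].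
  - left; apply filter_In; split; auto; apply Nat.eqb_eq; auto.
  - right; apply in_triangle in Hin.
    destruct (trial_divisor M P Q) as (d & Hd & [p Hp] & [q Hq]); [lia|auto|].
    apply in_flat_map; exists d; split; auto.
    assert (d <> 0)%nat by (intros ->; lia).
    apply in_map_iff; exists (p, q); simpl; split; [f_equal; lia|].
    pose proof (Nat.div_mod_eq M d); pose proof (Nat.mod_upper_bound M d ltac:(auto)).
    apply in_triangle; repeat split; nia.
Qed.

Lemma length_flat_map_sum {X Y} (g : X -> list Y) l :
  length (flat_map g l) = list_sum (map (fun x => length (g x)) l).
Proof. induction l; simpl; [auto|]; rewrite length_app; auto. Qed.

Lemma le_div a b c : 0 < c -> a * c <= b -> a <= b / c.
Proof.
  intros Hc H; apply Rmult_le_reg_r with c; auto.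
  unfold Rdiv; rewrite Rmult_assoc, Rinv_l; lra.
Qed.

Lemma length_triangle_div M d : (1 <= d)%nat ->
  INR (length (triangle (M / d))) <= INR M ^ 2 / (2 * INR d ^ 2) + INR M / (2 * INR d).
Proof.
  intros Hd; apply (le_INR 1) in Hd as HdR; simpl in HdR.
  set (t := (M / d)%nat).
  assert (Ht : INR t * INR d <= INR M).
  { rewrite <- mult_INR; apply le_INR; unfold t.
    rewrite Nat.mul_comm; apply Nat.Div0.mul_div_le. }
  assert (Ht' : INR t <= INR M / INR d) by (apply le_div; lra).
  assert (H2 : 2 * INR (length (triangle t)) = INR t * (INR t + 1)).
  { pose proof (length_triangle t) as H; apply (f_equal INR) in H.
    rewrite !mult_INR, plus_INR in H; simpl in H; lra. }
  replace (INR M ^ 2 / (2 * INR d ^ 2) + INR M / (2 * INR d))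
    with ((INR M / INR d) * (INR M / INR d + 1) / 2) by (field; lra).
  pose proof (pos_INR t); nra.
Qed.

(** The square of [2 * i + 3] exceeds [4 * (i + 1) * (i + 2)], so the quadratic term telescopes. The
    harmonic linear term is split into a telescoping part and a constant [M / 80], which costs
    [M ^ 2 / 80] over [M] divisors. *)
Lemma length_triangle_odd M i :
  INR (length (triangle (M / (2 * i + 3)))) <=
  (INR M ^ 2 / 8 + 5 / 4 * INR M) * (/ INR (i + 1) - / INR (i + 2)) + INR M / 80.
Proof.
  eapply Rle_trans; [apply length_triangle_div; lia|].
  rewrite !plus_INR, mult_INR; simpl INR.
  pose proof (pos_INR i) as Hi; pose proof (pos_INR M) as HM.
  set (y := INR i) in *; set (x := INR M) in *.
  replace ((1 + 1) * y + (1 + 1 + 1)) with (2 * y + 3) by ring.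
  assert (Hsq : / (2 * y + 3) ^ 2 <= / 4 * (/ (y + 1) - / (y + (1 + 1)))).
  { replace (/ 4 * (/ (y + 1) - / (y + (1 + 1)))) with (/ (4 * ((y + 1) * (y + 2))))
      by (field; lra).
    apply Rinv_le_contravar; nra. }
  set (u := / (2 * y + 3)).
  replace (/ (2 * y + 3) ^ 2) with (u ^ 2) in Hsq by (unfold u; field; lra).
  replace (x ^ 2 / (2 * (2 * y + 3) ^ 2) + x / (2 * (2 * y + 3)))
    with (x ^ 2 / 2 * u ^ 2 + x / 2 * u) by (unfold u; field; lra).
  (* AM-GM: [2 u <= 20 u^2 + 1/20] *)
  assert (Hu : x / 2 * u <= x / 4 * (20 * u ^ 2 + / 20)).
  { assert (0 <= (u - / 20) ^ 2) by apply pow2_ge_0.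
    assert (2 * u <= 20 * u ^ 2 + / 20) by nra; nra. }
  set (v := / (y + 1) - / (y + (1 + 1))) in *.
  assert (x ^ 2 / 2 * u ^ 2 <= x ^ 2 / 2 * (/ 4 * v)).
  { apply Rmult_le_compat_l; [|auto]; pose proof (pow2_ge_0 x); lra. }
  assert (5 * x * u ^ 2 <= 5 * x * (/ 4 * v)) by (apply Rmult_le_compat_l; lra).
  lra.
Qed.

Lemma sum_triangle_odd M n :
  INR (list_sum (map (fun i => length (triangle (M / (2 * i + 3)))) (seq 0 n))) <=
  (INR M ^ 2 / 8 + 5 / 4 * INR M) * (1 - / INR (n + 1)) + INR n * INR M / 80.
Proof.
  induction n as [|n IH]; [simpl; lra|].
  rewrite seq_S, map_app, list_sum_app, plus_INR.
  change (list_sum (map ?g ((0 + n)%nat :: nil))) with (g n + 0)%nat.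
  rewrite Nat.add_0_r; pose proof (length_triangle_odd M n) as H.
  rewrite S_INR; replace (S n + 1)%nat with (n + 2)%nat by lia; lra.
Qed.

(** The coefficient of [M ^ 2] that survives is [1/2 - 1/8 - 1/8 - 1/80 = 19/80], from the whole
    triangle, the divisor 2, the odd divisors and their linear terms; it exceeds [2/9]. *)
Lemma length_coprime_triangle M :
  2 / 9 * INR M ^ 2 - 2 * INR M <= INR (length (coprime_triangle M)).
Proof.
  pose proof (NoDup_incl_length (NoDup_triangle M) (triangle_incl M)) as H.
  rewrite length_app, length_flat_map_sum in H.
  rewrite (map_ext _ (fun d => length (triangle (M / d)))) in H
    by (intros; apply length_map).
  unfold trial_divisors in H; rewrite map_cons, map_map in H.
  change (list_sum (?a :: ?b)) with (a + list_sum b)%nat in H.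
  apply le_INR in H; rewrite !plus_INR in H.
  pose proof (length_triangle M) as H2; apply (f_equal INR) in H2.
  rewrite !mult_INR, plus_INR in H2; simpl (INR 2) in H2; simpl (INR 1) in H2.
  pose proof (length_triangle_div M 2 ltac:(lia)) as H3; simpl (INR 2) in H3.
  pose proof (sum_triangle_odd M M) as H4.
  pose proof (pos_INR M) as HM.
  assert (0 < / INR (M + 1)) by (apply Rinv_0_lt_compat, lt_0_INR; lia).
  assert (0 <= (INR M ^ 2 / 8 + 5 / 4 * INR M) * / INR (M + 1)).
  { apply Rmult_le_pos; [|lra]; pose proof (pow2_ge_0 (INR M)); lra. }
  set (s := list_sum _) in *.
  replace (INR M ^ 2 / (2 * (1 + 1) ^ 2) + INR M / (2 * (1 + 1)))
    with (INR M ^ 2 / 8 + INR M / 4) in H3 by field.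
  nra.
Qed.

(** * Counting words of a given length *)

Definition ind (P : Prop) : nat := if excluded_middle_informative P then 1 else 0.

(** Summing over all words reduces a recurrence between counts to an identity between indicators at
    each single word. *)
Fixpoint sum_words (N : nat) (f : list letter -> nat) : nat :=
  match N with
  | O => f nil
  | S N => sum_words N (fun w => f (A :: w)) + sum_words N (fun w => f (B :: w))
           + sum_words N (fun w => f (C :: w))
  end.

Definition count (N : nat) (P : list letter -> Prop) : nat :=
  sum_words N (fun w => ind (P w)).

Lemma sum_words_ext N : forall f g, (forall w, f w = g w) -> sum_words N f = sum_words N g.
Proof.
  induction N as [|N IH]; intros f g H; simpl; auto.
Qed.

Lemma sum_words_plus N : forall f g,
  sum_words N (fun w => f w + g w)%nat = (sum_words N f + sum_words N g)%nat.
Proof.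
  induction N as [|N IH]; intros f g; simpl; auto; rewrite !IH; lia.
Qed.

Lemma sum_words_snoc N : forall f, sum_words (S N) f =
  sum_words N (fun w => f (w ++ A :: nil) + f (w ++ B :: nil) + f (w ++ C :: nil))%nat.
Proof.
  induction N as [|N IH]; intros f; [reflexivity|].
  change (sum_words (S (S N)) f) with
    (sum_words (S N) (fun w => f (A :: w)) + sum_words (S N) (fun w => f (B :: w))
     + sum_words (S N) (fun w => f (C :: w)))%nat.
  rewrite (IH (fun w => f (A :: w))), (IH (fun w => f (B :: w))), (IH (fun w => f (C :: w))).
  reflexivity.
Qed.

Lemma sum_words_swap N : forall f, sum_words N (fun w => f (map swap w)) = sum_words N f.
Proof.
  induction N as [|N IH]; intros f; simpl; auto.
  rewrite (IH (fun w => f (A :: w))), (IH (fun w => f (B :: w))), (IH (fun w => f (C :: w))).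
  lia.
Qed.

Lemma count_list N : forall P, exists L, NoDup L /\
  (forall w, In w L <-> length w = N /\ P w) /\ length L = count N P.
Proof.
  unfold count; induction N as [|N IH]; intros P; simpl.
  - unfold ind; destruct (excluded_middle_informative (P nil)) as [HP|HP].
    + exists (nil :: nil); repeat split; simpl in *.
      * repeat constructor; auto.
      * destruct H as [<-|[]]; auto.
      * destruct H as [<-|[]]; auto.
      * intros [H _]; left; destruct w; [auto|discriminate].
    + exists nil; repeat split; simpl in *; try constructor; try tauto.
      intros [H HP']; destruct w; [auto|discriminate].
  - destruct (IH (fun w => P (A :: w))) as (LA & NA & IA & <-).
    destruct (IH (fun w => P (B :: w))) as (LB & NB & IB & <-).
    destruct (IH (fun w => P (C :: w))) as (LC & NC & IC & <-).
    assert (Hinj : forall a : letter, FinFun.Injective (cons a))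
      by (intros a x y [=]; auto).
    exists (map (cons A) LA ++ map (cons B) LB ++ map (cons C) LC); repeat split.
    + repeat apply NoDup_app; try (apply FinFun.Injective_map_NoDup; auto);
      intros w Hw Hw'; rewrite ?in_app_iff in Hw'; rewrite ?in_map_iff in *;
      repeat match goal with H : _ \/ _ |- _ => destruct H
        | H : exists _, _ |- _ => destruct H | H : _ /\ _ |- _ => destruct H end;
      congruence.
    + rewrite !in_app_iff, !in_map_iff in H.
      destruct H as [(v & <- & H)|[(v & <- & H)|(v & <- & H)]];
      [apply IA in H|apply IB in H|apply IC in H]; simpl; f_equal; tauto.
    + rewrite !in_app_iff, !in_map_iff in H.
      destruct H as [(v & <- & H)|[(v & <- & H)|(v & <- & H)]];
      [apply IA in H|apply IB in H|apply IC in H]; tauto.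
    + rewrite !in_app_iff, !in_map_iff; destruct w as [|[] w]; intros [H HP];
      [discriminate|left|right; left|right; right];
      exists w; split; auto; [apply IA|apply IB|apply IC]; auto.
    + rewrite !length_app, !length_map; lia.
Qed.

(** * Recurrences and polynomial bounds for the counts *)

Ltac by_cases :=
  unfold ind;
  repeat match goal with |- context [excluded_middle_informative ?P] =>
    destruct (excluded_middle_informative P) end;
  first [reflexivity | exfalso; tauto].

(** A factor has one left extension, plus one if it is in [special1] and one if it is in [special2];
    the reflection equates the last two counts. *)
Lemma count_factor_succ N :
  count (S N) factor = (count N factor + 2 * count N special1)%nat.
Proof.
  assert (H2 : count N special2 = count N special1).
  { unfold count; rewrite <- sum_words_swap; apply sum_words_ext; intros w.
    pose proof (special2_swap w); by_cases. }
  enough (count (S N) factor = count N factor + count N special1 + count N special2)%nat by lia.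
  unfold count; rewrite <- !sum_words_plus; simpl; rewrite <- !sum_words_plus.
  apply sum_words_ext; intros w.
  pose proof (factor_tail A w); pose proof (factor_tail B w); pose proof (factor_tail C w).
  pose proof (special1_factor w); pose proof (special2_factor w).
  pose proof (factor_special1 B w ltac:(congruence)).
  pose proof (factor_special1 C w ltac:(congruence)).
  pose proof (factor_special2 A w ltac:(congruence)).
  pose proof (factor_special2 B w ltac:(congruence)).
  assert (factor w -> factor (A :: w) \/ factor (B :: w) \/ factor (C :: w)).
  { intros H'; destruct (factor_extend w H') as [[] ?]; auto. }
  by_cases.
Qed.

(** A word in [special1] has one right extension that stays there, plus one for each kind of
    bispeciality. *)
Lemma count_special1_succ N :
  count (S N) special1 = (count N special1 + count N bispecial1 + count N bispecial2)%nat.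
Proof.
  unfold count; rewrite sum_words_snoc, <- !sum_words_plus.
  apply sum_words_ext; intros w.
  pose proof (special1_init w A); pose proof (special1_init w B).
  pose proof (special1_init w C).
  pose proof (bispecial1_special1 w); pose proof (bispecial2_special1 w).
  pose proof (special1_bispecial1 A w ltac:(congruence)).
  pose proof (special1_bispecial1 B w ltac:(congruence)).
  pose proof (special1_bispecial2 B w ltac:(congruence)).
  pose proof (special1_bispecial2 C w ltac:(congruence)).
  assert (special1 w -> special1 (w ++ A :: nil) \/ special1 (w ++ B :: nil)
            \/ special1 (w ++ C :: nil)).
  { intros H'; destruct (special1_extend w H') as [[] ?]; auto. }
  by_cases.
Qed.

(** The pairs [(nup w, nB w)] lie in the triangle [nB <= nup <= N]. *)
Lemma count_le_triangle N P :
  (forall w w', P w -> P w' -> length w = length w' -> nup w = nup w' ->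
     nB w = nB w' -> w = w') ->
  (2 * count N P <= (N + 1) * (N + 2))%nat.
Proof.
  intros Hinj; destruct (count_list N P) as (L & HL & Hin & <-).
  set (D := dprod (seq 0 (N + 1)) (fun u => seq 0 (u + 1))).
  assert (HD : (2 * length D = (N + 1) * (N + 2))%nat).
  { unfold D; rewrite length_dprod.
    rewrite (map_ext _ (fun u => u + 1)%nat) by (intros; apply length_seq).
    rewrite (map_ext _ S) by (intros; lia); rewrite seq_shift.
    pose proof (sum_seq 1 (N + 1)); lia. }
  rewrite <- HD; apply Nat.mul_le_mono_l.
  rewrite <- (length_map (fun w => (nup w, nB w))); apply NoDup_incl_length.
  - apply NoDup_map_NoDup_ForallPairs; auto.
    intros w w' Hw Hw' [=]; apply Hin in Hw, Hw'; apply Hinj; try tauto; lia.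
  - intros x Hx; apply in_map_iff in Hx; destruct Hx as (w & <- & Hw).
    apply Hin in Hw; destruct Hw as [Hw _].
    pose proof (nup_le_length w); pose proof (nB_le_nup w).
    apply in_dprod; rewrite !in_seq; lia.
Qed.

(** The pair is recovered from the word by [P = nup w + 1] and [P + Q = rot w + 2], so distinct
    pairs come from distinct words. *)
Lemma count_bispecial1_ge N : (length (coprime_triangle (N + 1)) <= count N bispecial1)%nat.
Proof.
  destruct (count_list N bispecial1) as (L & HL & Hin & <-).
  rewrite <- (length_map (fun w => (nup w + 1, rot w + 2 - (nup w + 1)))%nat L).
  apply NoDup_incl_length; [apply NoDup_filter, NoDup_triangle|].
  intros [P Q] Hx; apply filter_In in Hx; destruct Hx as [Hx Hg]; simpl in Hg.
  apply in_triangle in Hx; apply Nat.eqb_eq in Hg.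
  destruct (bispecial1_of_coprime P Q N) as (w & Hw & Hlen & HP & HQ); try lia.
  apply in_map_iff; exists w; split; [f_equal; lia|apply Hin; auto].
Qed.

(** The lower bound counts bispecial words of the first kind only. Both polynomials are shaped for
    induction: the increment of the upper one dominates [(N + 1) * (N + 2)], and that of the lower
    one is at most the bound on coprime pairs for [N + 1]. *)
Lemma count_special1_bounds N :
  2 / 27 * INR N ^ 3 - 2 * INR N ^ 2 <= INR (count N special1) <= (INR N + 2) ^ 3 / 3.
Proof.
  induction N as [|N IH].
  - unfold count; simpl sum_words; simpl INR; split; [pose proof (pos_INR (ind (special1 nil))); lra|].
    unfold ind; destruct (excluded_middle_informative _); simpl; lra.
  - rewrite count_special1_succ, !plus_INR, S_INR.
    pose proof (count_bispecial1_ge N) as H1; apply le_INR in H1.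
    pose proof (length_coprime_triangle (N + 1)) as H2.
    pose proof (count_le_triangle N bispecial1 bispecial1_inj) as H3; apply le_INR in H3.
    pose proof (count_le_triangle N bispecial2 bispecial2_inj) as H4; apply le_INR in H4.
    rewrite !mult_INR, !plus_INR in H3, H4; rewrite plus_INR in H2.
    simpl (INR 2) in *; simpl (INR 1) in *.
    pose proof (pos_INR (count N bispecial2)); pose proof (pos_INR N); nra.
Qed.

Lemma count_factor_bounds N :
  1 / 27 * INR N ^ 4 - 2 * INR N ^ 3 <= INR (count N factor) <= (INR N + 3) ^ 4 / 6.
Proof.
  induction N as [|N IH].
  - unfold count; simpl sum_words; simpl INR; split; [pose proof (pos_INR (ind (factor nil))); lra|].
    unfold ind; destruct (excluded_middle_informative _); simpl; lra.
  - rewrite count_factor_succ, plus_INR, mult_INR, S_INR; simpl (INR 2).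
    pose proof (count_special1_bounds N) as H; pose proof (pos_INR N); nra.
Qed.

(** * Bounds on the square of [PI], and the conclusion *)

Lemma PI_square_bounds : 9 <= PI ^ 2 <= 12.
Proof.
  (* Index 2 selects five terms of the Leibniz series, giving [PI < 3.34]; three terms would only
     bound the square by about 12.02. *)
  pose proof PI2_3_2 as H1; pose proof (PI_ineq 2) as [_ H2].
  unfold tg_alt, PI_tg in H2; simpl in H2; split; nra.
Qed.

Theorem mainTheorem1 :
  forall delta : R, delta > 0 ->
  exists K : R, K > 0 /\
  forall N : nat, (1 <= N)%nat ->
  exists L : list (list letter),
    NoDup L /\
    (forall w, In w L <-> (length w = N /\ is_3iet_factor w)) /\
    1 / (3 * PI ^ 2) * INR N ^ 4 - K * Rpower (INR N) (3 + delta)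
      <= INR (length L) /\
    INR (length L)
      <= 2 / PI ^ 2 * INR N ^ 4 + K * Rpower (INR N) (3 + delta).
Proof.
  (* One constant serves every [delta], as the error is of order [N ^ 3]: for [N >= 1] the lower
     terms of [(N + 3) ^ 4 / 6] total at most [(2 + 9 + 18 + 27/2) * N ^ 3], below [50 * N ^ 3]. *)
  intros delta Hdelta; exists 50; split; [lra|]; intros N HN.
  apply (le_INR 1) in HN; simpl in HN.
  destruct (count_list N factor) as (L & HL & Hin & Hlen).
  exists L; split; [auto|]; split.
  { intros w; rewrite Hin, is_3iet_factor_iff; tauto. }
  rewrite Hlen; pose proof (count_factor_bounds N) as [Hlo Hup].
  assert (Hpow : INR N ^ 3 <= Rpower (INR N) (3 + delta)).
  { rewrite <- Rpower_pow by lra; apply Rle_Rpower; [lra|simpl; lra]. }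
  pose proof PI_square_bounds as [HPI1 HPI2].
  set (x := INR N) in *; set (p := PI ^ 2) in *.
  assert (H4 : 0 <= x ^ 4) by (apply pow_le; lra).
  assert (H3 : 0 <= x ^ 3) by (apply pow_le; lra).
  assert (1 / (3 * p) * x ^ 4 <= 1 / 27 * x ^ 4).
  { apply Rmult_le_compat_r; auto; unfold Rdiv; rewrite !Rmult_1_l.
    apply Rinv_le_contravar; lra. }
  assert (1 / 6 * x ^ 4 <= 2 / p * x ^ 4).
  { apply Rmult_le_compat_r; auto; apply le_div; lra. }
  split; [lra|].
  assert (x ^ 2 <= x ^ 3) by nra.
  assert (x <= x ^ 3) by nra.
  assert (1 <= x ^ 3) by nra.
  replace ((x + 3) ^ 4 / 6) with
    (1 / 6 * x ^ 4 + (2 * x ^ 3 + 9 * x ^ 2 + 18 * x + 27 / 2)) in Hup by field.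
  lra.
Qed.
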